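(* Let $S$ be a Hausdorff pseudocompact topological semigroup which is algebraically a primitive inverse semigroup, $S=\sum_{i\in\mathscr I}B_{\lambda_i}(G_i)$. Then: (i) every cardinal $\lambda_i$ is finite; (ii) every non-zero maximal subgroup of $S$ is an open-and-closed subset of $S$ and hence is pseudocompact; (iii) for every $i\in\mathscr I$ the subspace $B_{\lambda_i}(G_i)$ is pseudocompact and each maximal subgroup $(G_i)_{\alpha,\alpha}$ is a pseudocompact paratopological group; (iv) if $\mathscr B$ is a base of the topology at the unit $(\alpha_i,e_i,\alpha_i)$ of $(G_i)_{\alpha_i,\alpha_i}$ with $U\subseteq (G_i)_{\alpha_i,\alpha_i}$ for all $U\in\mathscr B$, then for all $\beta_i,\gamma_i\in\lambda_i$ and $x\in G_i$ the family $\{(\beta_i,x,\alpha_i)\cdot U\cdot(\alpha_i,e_i,\gamma_i):U\in\mathscr B\}$ is a base of the topology at $(\beta_i,x,\gamma_i)$; (v) if moreover $S$ is semiregular, then the family of all sets $S\setminus\big((G_{i_1})_{\alpha_1,\beta_1}\cup\dots\cup(G_{i_k})_{\alpha_k,\beta_k}\big)$, where $k\in\mathbb N$, $i_1,\dots,i_k\in\mathscr I$, $\alpha_j,\beta_j\in\lambda_{i_j}$, is a base of the topology of $S$ at zero.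
   Context: A topological semigroup is a Hausdorff space with jointly continuous associative operation; a paratopological group is a group with Hausdorff topology and jointly continuous multiplication. Pseudocompact: every locally finite family of non-empty open sets is finite; semiregular: having a base of regular open sets. For a group $G$ and cardinal $\lambda\ge1$, $B_\lambda(G)=(\lambda\times G\times\lambda)\cup\{0\}$ with $(\alpha,a,\beta)(\gamma,b,\delta)=(\alpha,ab,\delta)$ if $\beta=\gamma$ and $0$ otherwise. The orthogonal sum of semigroups $T_\iota$ with zeros is $\{0\}\cup\bigcup_\iota(T_\iota\setminus\{0_\iota\})$ with products computed in $T_\iota$ when both factors lie in the same $T_\iota$ and the product is non-zero, and $0$ otherwise. Primitive inverse semigroups are exactly orthogonal sums $\sum_{i\in\mathscr I}B_{\lambda_i}(G_i)$; we identify $B_{\lambda_i}(G_i)$ with a subsemigroup of $S$, write $(G_i)_{\alpha,\beta}=\{(\alpha,g,\beta):g\in G_i\}$, $e_i$ for the unit of $G_i$; maximal subgroups of $S$ are $\{0\}$ and the $(G_i)_{\alpha,\alpha}$, with subspace topology. *)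

(* Defs.v *)
From Stdlib Require Import List Classical ClassicalEpsilon.
Set Implicit Arguments.

Record topology (X : Type) := Topology {
  open : (X -> Prop) -> Prop;
  open_full : open (fun _ => True);
  open_union : forall F : (X -> Prop) -> Prop,
      (forall U, F U -> open U) -> open (fun x => exists U, F U /\ U x);
  open_inter : forall U V, open U -> open V -> open (fun x => U x /\ V x)
}.
Arguments open {X} t U.

Definition subset {X} (A B : X -> Prop) := forall x, A x -> B x.

Definition closed {X} (T : topology X) (A : X -> Prop) :=
  open T (fun x => ~ A x).

Definition clopen {X} (T : topology X) (A : X -> Prop) := open T A /\ closed T A.

Definition hausdorff {X} (T : topology X) :=
  forall x y, x <> y -> exists U V, open T U /\ open T V /\ U x /\ V y /\
    (forall z, U z -> V z -> False).

Definition interior {X} (T : topology X) (A : X -> Prop) (x : X) :=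
  exists W, open T W /\ W x /\ subset W A.

Definition closure {X} (T : topology X) (A : X -> Prop) (x : X) :=
  forall W, open T W -> W x -> exists y, W y /\ A y.

Definition regular_open {X} (T : topology X) (U : X -> Prop) :=
  forall x, U x <-> interior T (closure T U) x.

Definition semiregular {X} (T : topology X) :=
  forall x W, open T W -> W x ->
    exists U, open T U /\ regular_open T U /\ U x /\ subset U W.

Definition base_at {X} (T : topology X) (x : X) (B : (X -> Prop) -> Prop) :=
  (forall U, B U -> open T U /\ U x) /\
  (forall W, open T W -> W x -> exists U, B U /\ subset U W).

Definition finite_family {X} (F : (X -> Prop) -> Prop) :=
  exists l : list (X -> Prop), forall U, F U -> exists V, In V l /\ forall x, U x <-> V x.

Definition locally_finite {X} (T : topology X) (F : (X -> Prop) -> Prop) :=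
  forall x, exists W, open T W /\ W x /\
    finite_family (fun U => F U /\ exists y, U y /\ W y).

Definition pseudocompact {X} (T : topology X) :=
  forall F : (X -> Prop) -> Prop,
    (forall U, F U -> open T U /\ exists x, U x) ->
    locally_finite T F -> finite_family F.

Section Subspace.
Variables (X : Type) (T : topology X) (A : X -> Prop).
Definition sub_open (V : {x | A x} -> Prop) :=
  exists U, open T U /\ forall z, V z <-> U (proj1_sig z).

Lemma sub_open_full : sub_open (fun _ => True).
Proof. exists (fun _ => True); split; [apply open_full | tauto]. Qed.

Lemma sub_open_union : forall F : ({x | A x} -> Prop) -> Prop,
  (forall U, F U -> sub_open U) -> sub_open (fun x => exists U, F U /\ U x).
Proof.
  intros F HF.
  exists (fun x => exists U, (open T U /\ exists V, F V /\ forall z, V z <-> U (proj1_sig z)) /\ U x).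
  split.
  - apply open_union. intros U [HU _]; exact HU.
  - intros z; split.
    + intros [V [FV Vz]]. destruct (HF V FV) as [U [HU HVU]].
      exists U; split; [split; [exact HU | exists V; auto] | apply HVU; exact Vz].
    + intros [U [[_ [V [FV HVU]]] Uz]]. exists V; split; [exact FV | apply HVU; exact Uz].
Qed.

Lemma sub_open_inter : forall U V, sub_open U -> sub_open V ->
  sub_open (fun x => U x /\ V x).
Proof.
  intros U V [U' [HU HUU]] [V' [HV HVV]].
  exists (fun x => U' x /\ V' x); split; [apply open_inter; auto |].
  intros z; rewrite HUU, HVV; tauto.
Qed.

Definition subspace : topology {x | A x} :=
  @Topology _ sub_open sub_open_full sub_open_union sub_open_inter.
End Subspace.

Definition paratopological_subgroup {X} (T : topology X) (mul : X -> X -> X)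
  (A : X -> Prop) :=
  (exists e, A e /\
     (forall x y, A x -> A y -> A (mul x y)) /\
     (forall x, A x -> mul e x = x /\ mul x e = x) /\
     (forall x, A x -> exists y, A y /\ mul x y = e /\ mul y x = e)) /\
  hausdorff (subspace T A) /\
  (forall x y W, A x -> A y -> open T W -> W (mul x y) ->
     exists U V, open T U /\ open T V /\ U x /\ V y /\
       forall a b, A a -> A b -> U a -> V b -> W (mul a b)).

Definition jointly_continuous {X} (T : topology X) (mul : X -> X -> X) :=
  forall x y W, open T W -> W (mul x y) ->
    exists U V, open T U /\ open T V /\ U x /\ V y /\
      forall a b, U a -> V b -> W (mul a b).

Record Grp := {
  gcar :> Type;
  gmul : gcar -> gcar -> gcar;
  gone : gcar;
  ginv : gcar -> gcar;
  gmulA : forall x y z, gmul x (gmul y z) = gmul (gmul x y) z;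
  gmul1 : forall x, gmul gone x = x;
  gmulV : forall x, gmul (ginv x) x = gone
}.

(* Index set I; L i is (a set of cardinality) lambda_i; G i is the group G_i.
   None is the zero 0; Some (existT i (a, g, b)) is (a, g, b) in B_{lambda_i}(G_i). *)
Section PrimInv.
Variables (I : Type) (L : I -> Type) (G : I -> Grp).

Definition PIS := option {i : I & (L i * G i * L i)%type}.

Definition pmul (x y : PIS) : PIS :=
  match x, y with
  | Some (existT _ i (a, g, b)), Some (existT _ j (c, h, d)) =>
    match excluded_middle_informative (i = j) with
    | left p =>
      match p in _ = j' return L j' -> G j' -> L j' -> PIS with
      | eq_refl => fun c h d =>
          if excluded_middle_informative (b = c)
          then Some (existT _ i (a, gmul (G i) g h, d)) else None
      end c h d
    | right _ => None
    end
  | _, _ => None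
  end.

Definition pelt (i : I) (a : L i) (g : G i) (b : L i) : PIS :=
  Some (existT _ i (a, g, b)).

Definition Gab (i : I) (a b : L i) (z : PIS) : Prop :=
  exists g, z = @pelt i a g b.

Definition Bsub (i : I) (z : PIS) : Prop :=
  z = None \/ exists a g b, z = @pelt i a g b.

End PrimInv.
Arguments pmul {I L G} x y.
Arguments pelt {I L} G i a g b.
Arguments Gab {I L} G i a b z.
Arguments Bsub {I L} G i z.

(* Main.v *)
(* Multiplying by idempotents shows that every set G_{a,b} is open, so a family of open
   sets, one inside each G_{a,b}, can only accumulate at 0. Removing from the G_{a,b} the
   closure of a suitable neighbourhood of 0 gives families which do not accumulate there
   either, hence are finite: this yields (i) and (v). For (ii) one must keep 0 out of the
   closure of a maximal subgroup H. Inversion need not be continuous on H, but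
   pseudocompactness makes it continuous up to closures (D^-1 contained in cl E), and a
   precompactness argument then bounds H away from 0, because elements of H close to 0
   have inverses far from 0. *)
Require Import Defs.
From Stdlib Require Import List Classical ClassicalEpsilon.
From Stdlib Require Import FunctionalExtensionality PropExtensionality.
From Stdlib Require Import ProofIrrelevance Eqdep Arith Lia.

Set Implicit Arguments.

(** * Open sets and closures in an arbitrary space *)

Lemma open_iff {X} (T : topology X) (A B : X -> Prop) :
  (forall x, A x <-> B x) -> open T A -> open T B.
Proof.
  intros H HA. replace B with A; [exact HA |].
  extensionality x. apply propositional_extensionality, H.
Qed.

Lemma open_nbhd {X} (T : topology X) (A : X -> Prop) :
  (forall x, A x -> exists W, open T W /\ W x /\ subset W A) -> open T A.
Proof.
  intros H.
  apply (@open_iff _ T (fun x => exists W, (open T W /\ subset W A) /\ W x)).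
  - intros x; split.
    + intros [W [[_ HW] Wx]]. exact (HW x Wx).
    + intros Ax. destruct (H x Ax) as [W [HW [Wx WA]]]. exists W; auto.
  - apply open_union. intros U [HU _]; exact HU.
Qed.

Lemma open_const {X} (T : topology X) (P : Prop) : open T (fun _ => P).
Proof.
  apply open_nbhd. intros x p. exists (fun _ => True).
  split; [apply open_full | split; [exact I | intros y _; exact p]].
Qed.

Lemma open_or {X} (T : topology X) (A B : X -> Prop) :
  open T A -> open T B -> open T (fun x => A x \/ B x).
Proof.
  intros HA HB. apply open_nbhd. intros x [Ax | Bx].
  - exists A; split; [exact HA | split; [exact Ax | intros y; auto]].
  - exists B; split; [exact HB | split; [exact Bx | intros y; auto]].
Qed.

Lemma open_forall_in {X K} (T : topology X) (l : list K) (A : K -> X -> Prop) :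
  (forall k, In k l -> open T (A k)) -> open T (fun x => forall k, In k l -> A k x).
Proof.
  induction l as [| k l IH]; intros H.
  - apply (@open_iff _ T (fun _ => True)); [| apply open_full]. simpl; tauto.
  - apply (@open_iff _ T (fun x => A k x /\ (forall k', In k' l -> A k' x))).
    + intros x; simpl; split.
      * intros [H1 H2] k' [<- | Hk]; auto.
      * intros H1; split; auto.
    + apply open_inter; [apply H; simpl; auto | apply IH; intros k' Hk; apply H; simpl; auto].
Qed.

Lemma open_not_closure {X} (T : topology X) (A : X -> Prop) :
  open T (fun x => ~ closure T A x).
Proof.
  apply open_nbhd. intros x Hx. apply not_all_ex_not in Hx. destruct Hx as [W HW].
  apply imply_to_and in HW. destruct HW as [HW HWx].
  apply imply_to_and in HWx. destruct HWx as [Wx Hn].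
  exists W; split; [exact HW | split; [exact Wx |]].
  intros y Wy Hy. apply Hn. exact (Hy W HW Wy).
Qed.

Lemma subset_closure {X} (T : topology X) (A : X -> Prop) : subset A (closure T A).
Proof. intros x Ax W _ Wx. exists x; auto. Qed.

Lemma closure_disjoint_open {X} (T : topology X) (A B : X -> Prop) (x : X) :
  open T B -> (forall y, A y -> B y -> False) -> closure T A x -> B x -> False.
Proof.
  intros HB H Hx Bx. destruct (Hx B HB Bx) as [y [By Ay]]. exact (H y Ay By).
Qed.

(** * Translations, closures and idempotents in a topological semigroup *)

Section TopologicalSemigroup.
Context {X : Type} {T : topology X} {mul : X -> X -> X}.
Hypothesis Hmul : jointly_continuous T mul.

Lemma open_mul_l x (W : X -> Prop) : open T W -> open T (fun y => W (mul x y)).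
Proof.
  intros HW. apply open_nbhd. intros y Wy.
  destruct (Hmul x y W HW Wy) as [U [V [HU [HV [Ux [Vy H]]]]]].
  exists V; split; [exact HV | split; [exact Vy | intros b Vb; exact (H x b Ux Vb)]].
Qed.

Lemma open_mul_r y (W : X -> Prop) : open T W -> open T (fun x => W (mul x y)).
Proof.
  intros HW. apply open_nbhd. intros x Wx.
  destruct (Hmul x y W HW Wx) as [U [V [HU [HV [Ux [Vy H]]]]]].
  exists U; split; [exact HU | split; [exact Ux | intros a Ua; exact (H a y Ua Vy)]].
Qed.

(** Joint continuity puts the product of two closures inside the closure of the product; [C] is any
    set containing that product. *)
Lemma closure_mul (A B C : X -> Prop) x y :
  (forall a b, A a -> B b -> C (mul a b)) ->
  closure T A x -> closure T B y -> closure T C (mul x y).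
Proof.
  intros H Hx Hy W HW Wxy.
  destruct (Hmul x y W HW Wxy) as [U [V [HU [HV [Ux [Vy HUV]]]]]].
  destruct (Hx U HU Ux) as [a [Ua Aa]]. destruct (Hy V HV Vy) as [b [Vb Bb]].
  exists (mul a b); auto.
Qed.

Lemma square_nbhd e (W : X -> Prop) :
  mul e e = e -> open T W -> W e ->
  exists U, open T U /\ U e /\ subset U W /\ forall a b, U a -> U b -> W (mul a b).
Proof.
  intros Hee HW We.
  assert (Wee : W (mul e e)) by (rewrite Hee; exact We).
  destruct (Hmul e e W HW Wee) as [U [V [HU [HV [Ue [Ve H]]]]]].
  exists (fun x => W x /\ (U x /\ V x)).
  split; [repeat (apply open_inter; try assumption) |].
  split; [auto | split; [intros x; tauto |]].
  intros a b [_ [Ua _]] [_ [_ Vb]]; auto.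
Qed.
End TopologicalSemigroup.

(** * Dependent choice and indexed forms of pseudocompactness *)

Lemma dependent_choice_inv {A : Type} (P : A -> Prop) (R : A -> A -> Prop) (a0 : A) :
  P a0 -> (forall a, P a -> exists b, P b /\ R a b) ->
  exists f : nat -> A, f 0 = a0 /\ forall n, P (f n) /\ R (f n) (f (S n)).
Proof.
  intros H0 Hstep.
  (* The invariant is packed into the state type, so that the step becomes a total function that can
     be iterated. *)
  assert (Hs : forall a : {a | P a}, exists b : {a | P a}, R (proj1_sig a) (proj1_sig b)).
  { intros [a Pa]. destruct (Hstep a Pa) as [b [Pb Rab]]. exists (exist _ b Pb); exact Rab. }
  pose (next a := proj1_sig (constructive_indefinite_description _ (Hs a))).
  pose (f := fix f n := match n with 0 => exist _ a0 H0 | S n => next (f n) end).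
  exists (fun n => proj1_sig (f n)). split; [reflexivity |].
  intros n; split; [exact (proj2_sig (f n)) |].
  exact (proj2_sig (constructive_indefinite_description _ (Hs (f n)))).
Qed.

(** [finite_family] counts sets, not indices, and infinitely many [R k] might coincide. Local
    finiteness is therefore demanded of the indices, which makes every non-empty set occur only
    finitely often. *)
Lemma pseudocompact_index_finite {X K} (T : topology X) (D : K -> Prop)
  (R : K -> X -> Prop) :
  pseudocompact T ->
  (forall k, D k -> open T (R k) /\ exists x, R k x) ->
  (forall x, exists W, open T W /\ W x /\
     exists l, forall k, D k -> (exists y, R k y /\ W y) -> In k l) ->
  exists l, forall k, D k -> In k l.
Proof.
  intros Hpc HR Hloc.
  destruct (Hpc (fun U => exists k, D k /\ U = R k)) as [sets Hsets].
  - intros U [k [Dk ->]]; auto.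
  - intros x. destruct (Hloc x) as [W [HW [Wx [l Hl]]]].
    exists W; split; [exact HW | split; [exact Wx |]].
    exists (map R l). intros U [[k [Dk ->]] Hy]. exists (R k). split; [| tauto].
    apply in_map, Hl; auto.
  - assert (H : exists l, forall k, D k ->
        (exists V, In V sets /\ forall x, R k x <-> V x) -> In k l).
    { clear Hsets. induction sets as [| V sets [l Hl]].
      - exists nil. intros k _ [V [[] _]].
      (* A point of [V] has a neighbourhood meeting [R k] for finitely many [k] only, which bounds
         the indices with [R k] equal to [V]; an empty [V] equals no [R k]. *)
      - destruct (classic (exists x, V x)) as [[x Vx] | HV].
        + destruct (Hloc x) as [W [HW [Wx [l' Hl']]]].
          exists (l' ++ l). intros k Dk [V' [[<- | HV'] HRV]]; apply in_or_app.
          * left. apply Hl'; [exact Dk |]. exists x; split; [apply HRV |]; assumption.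
          * right. apply Hl; [exact Dk |]. exists V'; auto.
        + exists l. intros k Dk [V' [[<- | HV'] HRV]].
          * destruct (HR k Dk) as [_ [x Rx]]. exfalso. apply HV. exists x. apply HRV, Rx.
          * apply Hl; [exact Dk |]. exists V'; auto. }
    destruct H as [l Hl]. exists l. intros k Dk. apply Hl; [exact Dk |].
    apply Hsets. exists k; auto.
Qed.

(** Otherwise each point has a neighbourhood that meets [Y n] only for [n] below some bound, and the
    indexed form would make [nat] finite. *)
Lemma pseudocompact_accumulation {X} (T : topology X) (Y : nat -> X -> Prop) :
  pseudocompact T ->
  (forall n, open T (Y n) /\ exists x, Y n x) ->
  exists p, forall W, open T W -> W p -> forall N, exists n, N <= n /\ exists y, Y n y /\ W y.
Proof.
  intros Hpc HY. apply NNPP. intros Hno.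
  destruct (@pseudocompact_index_finite X nat T (fun _ => True) Y Hpc) as [l Hl].
  - auto.
  - intros x. pose proof (not_ex_all_not _ _ Hno x) as Hx. simpl in Hx.
    apply not_all_ex_not in Hx. destruct Hx as [W HW].
    apply imply_to_and in HW. destruct HW as [HW HWx].
    apply imply_to_and in HWx. destruct HWx as [Wx HN].
    apply not_all_ex_not in HN. destruct HN as [N HN].
    exists W; split; [exact HW | split; [exact Wx |]].
    exists (seq 0 N). intros n _ Hn. apply in_seq.
    destruct (le_lt_dec N n) as [HNn | HNn]; [| lia].
    exfalso. apply HN. exists n; auto.
  - assert (Hb : forall l' : list nat, exists N, forall n, In n l' -> n < N).
    { induction l' as [| m l' [N HN]].
      - exists 0. intros n [].
      - exists (S m + N). intros n [<- | Hn]; [lia |]. specialize (HN n Hn). lia. }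
    destruct (Hb l) as [N HN]. specialize (HN N (Hl N I)). lia.
Qed.

(** * Group identities from the left-handed axioms *)

Section Groups.
Context {G : Grp}.
Implicit Types x y : G.

Lemma gmulKg x y : gmul G (ginv G x) (gmul G x y) = y.
Proof. now rewrite gmulA, gmulV, gmul1. Qed.

Lemma gmul1r x : gmul G x (gone G) = x.
Proof.
  rewrite <- (gmulKg (ginv G x) (gmul G x (gone G))), (gmulKg x), <- (gmulV G x).
  apply gmulKg.
Qed.

Lemma ginvK x : ginv G (ginv G x) = x.
Proof. rewrite <- (gmulKg (ginv G x) x) at 2. now rewrite gmulV, gmul1r. Qed.

Lemma gmulVr x : gmul G x (ginv G x) = gone G.
Proof. rewrite <- (ginvK x) at 1. apply gmulV. Qed.

Lemma gmulKVg x y : gmul G x (gmul G (ginv G x) y) = y.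
Proof. now rewrite gmulA, gmulVr, gmul1. Qed.

Lemma ginvM x y : ginv G (gmul G x y) = gmul G (ginv G y) (ginv G x).
Proof.
  rewrite <- (gmulKg (gmul G x y) (gmul G (ginv G y) (ginv G x))).
  now rewrite <- gmulA, gmulKVg, gmulVr, gmul1r.
Qed.

Lemma ginv1 : ginv G (gone G) = gone G.
Proof. rewrite <- (gmul1r (ginv G (gone G))). apply gmulV. Qed.
End Groups.

(** Normalises group words: inverses are pushed to the letters, products are associated to the
    right, and adjacent inverse letters cancel. *)
Ltac gsimp := repeat first
  [ rewrite <- gmulA | rewrite gmul1 | rewrite gmul1r | rewrite gmulV | rewrite gmulVr
  | rewrite gmulKg | rewrite gmulKVg | rewrite ginvM | rewrite ginvK | rewrite ginv1 ].

(** * Separating an open group from the only other possible point [z] of its closure *)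

Section ZeroIsolated.
Context {X : Type} {T : topology X} {mul : X -> X -> X} {G : Grp} {h : G -> X} {z : X}.
Hypothesis HT : hausdorff T.
Hypothesis Hmul : jointly_continuous T mul.
Hypothesis Hpc : pseudocompact T.
Hypothesis hM : forall x y, mul (h x) (h y) = h (gmul G x y).
Hypothesis zz : mul z z = z.
Hypothesis zh : forall x, mul z (h x) = z.
Hypothesis hz : forall x, h x <> z.
Let range w := exists x, w = h x.
Hypothesis range_open : open T range.
Hypothesis range_closure : forall w, closure T range w -> range w \/ w = z.

(** An accumulation point of the [Y n] lies in the closure of [range], and it is not [z] because [Z]
    misses every [Y n]; so it is some [h q]. *)
Lemma accumulation_in_range (Y : nat -> X -> Prop) (Z : X -> Prop) :
  open T Z -> Z z ->
  (forall n, open T (Y n) /\ (exists x, Y n x) /\ forall w, Y n w -> range w /\ ~ Z w) ->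
  exists q, forall W, open T W -> W (h q) ->
    forall N, exists n, N <= n /\ exists x, Y n (h x) /\ W (h x).
Proof.
  intros HZ Zz HY.
  destruct (@pseudocompact_accumulation X T Y Hpc) as [p Hp].
  { intros n. destruct (HY n) as [H1 [H2 _]]; auto. }
  destruct (range_closure (w := p)) as [[q ->] | ->].
  - intros W HW Wp. destruct (Hp W HW Wp 0) as [n [_ [y [Yy Wy]]]].
    exists y; split; [exact Wy | apply (HY n), Yy].
  - exists q. intros W HW Wq N. destruct (Hp W HW Wq N) as [n [Hn [y [Yy Wy]]]].
    destruct (HY n) as [_ [_ Hr]]. destruct (Hr y Yy) as [[x ->] _].
    exists n; split; [exact Hn | exists x; auto].
  - exfalso. destruct (Hp Z HZ Zz 0) as [n [_ [y [Yy Zy]]]].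
    destruct (HY n) as [_ [_ Hr]]. apply (Hr y Yy), Zy.
Qed.

(* Were this false, one could walk x_{n+1} = x_n g_n with g_n ever smaller and
   g_n^-1 outside cl E, inside nested V_{n+1} = V_n /\ x_{n+1} W. An accumulation
   point q of the sets Y_n = V_n \ x_{n+1} (cl E) lies in every x_{n+1} (cl W), so
   q W, which meets some Y_n, would put a point of Y_n in x_{n+1} (cl E). *)
Lemma inverse_almost_continuous (E : X -> Prop) :
  open T E -> E (h (gone G)) ->
  exists D, open T D /\ D (h (gone G)) /\ forall x, D (h x) -> closure T E (h (ginv G x)).
Proof.
  intros HE E1. apply NNPP. intros Hno.
  assert (Hbad : forall D, open T D -> D (h (gone G)) ->
    exists x, D (h x) /\ ~ closure T E (h (ginv G x))).
  { intros D HD D1. apply NNPP. intros H. apply Hno. exists D.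
    split; [exact HD | split; [exact D1 |]].
    intros x Dx. apply NNPP. intros Hx. apply H. exists x; auto. }
  clear Hno.
  assert (h11 : mul (h (gone G)) (h (gone G)) = h (gone G)) by (rewrite hM; gsimp; reflexivity).
  destruct (HT (@hz (gone G))) as [V0 [Z [HV0 [HZ [V01 [Zz HVZ]]]]]].
  destruct (square_nbhd Hmul _ h11 HE E1) as [W1 [HW1 [W11 [_ HWE]]]].
  (* Intersecting with [V0] and [range] keeps every [V n], hence every [Y n], in the group and off
     the neighbourhood [Z] of [z]. *)
  set (W := fun w => W1 w /\ (V0 w /\ range w)).
  assert (HW : open T W) by (repeat (apply open_inter; try assumption)).
  assert (W1' : W (h (gone G))) by (repeat split; auto; exists (gone G); reflexivity).
  (* A state is the pair of [x_n] and [V_n]. The second clause is the condition on [g_n^-1], since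
     [x_{n+1}^-1 x_n = g_n^-1]. *)
  set (next := fun s s' : G * (X -> Prop) =>
    snd s (h (fst s')) /\
    ~ closure T E (h (gmul G (ginv G (fst s')) (fst s))) /\
    snd s' = fun w => snd s w /\ W (mul (h (ginv G (fst s'))) w)).
  destruct (@dependent_choice_inv _ (fun s => open T (snd s) /\ snd s (h (fst s))) next
              (gone G, W)) as [f [f0 Hf]].
  { split; assumption. }
  { intros [x V] [HV Vx]; simpl in *.
    destruct (Hbad (fun w => V (mul (h x) w))) as [g [Vg Hg]].
    - apply (open_mul_l Hmul), HV.
    - rewrite hM. gsimp. exact Vx.
    - rewrite hM in Vg.
      exists (gmul G x g, fun w => V w /\ W (mul (h (ginv G (gmul G x g))) w)).
      split; [split |]; unfold next; simpl.
      + apply open_inter; [exact HV | apply (open_mul_l Hmul), HW].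
      + split; [exact Vg |]. rewrite hM. gsimp. exact W1'.
      + split; [exact Vg | split; [| reflexivity]]. gsimp. exact Hg. }
  set (x n := fst (f n)). set (V n := snd (f n)).
  assert (HV : forall n, open T (V n)) by (intros n; apply Hf).
  assert (Vx : forall n, V n (h (x n))) by (intros n; apply Hf).
  assert (VS : forall n w, V (S n) w <-> V n w /\ W (mul (h (ginv G (x (S n)))) w)).
  { intros n w. destruct (Hf n) as [_ [_ [_ H]]]. unfold V. rewrite H. reflexivity. }
  assert (Hx : forall n, ~ closure T E (h (gmul G (ginv G (x (S n))) (x n)))).
  { intros n. apply Hf. }
  assert (Vmono : forall m n w, m <= n -> V n w -> V m w).
  { intros m n w Hmn. induction Hmn as [| n Hmn IH]; [auto |].
    intros Hw. apply IH, VS, Hw. }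
  assert (VW : forall n w, V n w -> W w).
  { intros n w Hw. assert (H : V 0 w) by (apply (@Vmono 0 n w); [lia | exact Hw]).
    unfold V in H. rewrite f0 in H. exact H. }
  set (Y n w := V n w /\ ~ closure T E (mul (h (ginv G (x (S n)))) w)).
  destruct (@accumulation_in_range Y Z HZ Zz) as [q Hq].
  { intros n. split; [| split].
    - apply open_inter; [apply HV |].
      apply (open_mul_l Hmul (h (ginv G (x (S n)))) (fun w => ~ closure T E w)).
      apply open_not_closure.
    - exists (h (x n)). split; [apply Vx |]. rewrite hM. apply Hx.
    - intros w [Vw _]. destruct (VW n w Vw) as [_ [V0w Rw]].
      split; [exact Rw |]. intros Zw. exact (HVZ w V0w Zw). }
  destruct (Hq (fun w => W (mul (h (ginv G q)) w))) with (N := 0)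
    as [m [_ [g [[_ Yg] Wg]]]].
  { apply (open_mul_l Hmul), HW. }
  { rewrite hM. gsimp. exact W1'. }
  rewrite hM in Yg, Wg. apply Yg.
  intros O HO Og.
  (* With [m] and [g] fixed, accumulation at [q] is used again beyond [S m], where [V n] is inside
     [V (S m)]. So [x_{m+1}^-1 g'] is in [W], and its product with [q^-1 g], also in [W], is a point
     of [E] inside [O]. *)
  destruct (Hq (fun w => O (mul (h (ginv G (x (S m)))) (mul w (h (gmul G (ginv G q) g))))))
    with (N := S m) as [n [Hn [g' [[Vg' _] Og']]]].
  { apply (open_mul_r Hmul _ (fun w => O (mul _ w))).
    apply (open_mul_l Hmul), HO. }
  { rewrite !hM. gsimp. exact Og. }
  apply (Vmono (S m) n) in Vg'; [| exact Hn]. apply VS in Vg'. destruct Vg' as [_ Wg'].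
  eexists; split; [exact Og' |].
  rewrite !hM in *. rewrite gmulA, <- hM. apply HWE; [apply Wg' | apply Wg].
Qed.

(* The elements g with gD disjoint from a neighbourhood of z include all inverses of
   elements near z; by pseudocompactness they are covered by finitely many
   y D D^-1 D D^-1, so elements near z lie in finitely many D D^-1 D D^-1 y^-1,
   and these stay away from z. *)
Lemma zero_not_in_closure : exists V, open T V /\ V z /\ forall x, ~ V (h x).
Proof.
  assert (h11 : mul (h (gone G)) (h (gone G)) = h (gone G)) by (rewrite hM; gsimp; reflexivity).
  (* [O] is halved twice: [E E] lies in [E1] and [E1 E1] in [O]. Then [D D^-1] lies in the closure
     of [E1], and its square in the closure of [O], which misses [Z]. *)
  destruct (HT (@hz (gone G))) as [O [Z [HO [HZ [O1 [Zz HOZ]]]]]].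
  destruct (square_nbhd Hmul _ h11 HO O1) as [E1 [HE1 [E11 [E1O HE1O]]]].
  destruct (square_nbhd Hmul _ h11 HE1 E11) as [E [HE [E_1 [EE1 HEE1]]]].
  destruct (inverse_almost_continuous E HE E_1) as [D0 [HD0 [D01 HD0E]]].
  set (D := fun w => D0 w /\ E w).
  assert (HD : open T D) by (apply open_inter; assumption).
  assert (D1 : D (h (gone G))) by (split; assumption).
  assert (HDE : forall d d', D (h d) -> D (h d') -> closure T E1 (h (gmul G d (ginv G d')))).
  { intros d d' [_ Ed] [D0d' _]. rewrite <- hM.
    apply (closure_mul Hmul (A := E) (B := E)); auto. apply subset_closure, Ed. }
  destruct (square_nbhd Hmul _ zz HZ Zz) as [Z' [HZ' [Z'z [_ HZZ]]]].
  set (C g := forall d, D (h d) -> ~ Z' (h (gmul G g d))).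
  set (near y x := exists d1 d2 d3 d4, D (h d1) /\ D (h d2) /\ D (h d3) /\ D (h d4) /\
    x = gmul G y (gmul G (gmul G d1 (ginv G d2)) (gmul G d3 (ginv G d4)))).
  assert (Hcover : exists l, forall g, C g -> exists y, In y l /\ near y g).
  { apply NNPP. intros Hno.
    (* Without a finite cover, each new element of [C] can be chosen not [near] any earlier one; the
       state is the list of earlier choices. *)
    destruct (@dependent_choice_inv (list G) (fun _ => True)
      (fun l l' => exists g, l' = g :: l /\ C g /\ forall y, In y l -> ~ near y g) nil I)
      as [f [_ Hf]].
    { intros l _. apply NNPP. intros H. apply Hno. exists l. intros g Cg.
      apply NNPP. intros Hg. apply H. exists (g :: l). split; [exact I |].
      exists g. split; [reflexivity | split; [exact Cg |]].
      intros y Hy Hn. apply Hg. exists y; auto. }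
    (* The default [gone G] is never returned, because [f (S n)] is a cons. *)
    set (x n := hd (gone G) (f (S n))).
    assert (fS : forall n, f (S n) = x n :: f n /\ C (x n) /\
      forall y, In y (f n) -> ~ near y (x n)).
    { intros n. unfold x. destruct (Hf n) as [_ [g [-> H]]]. split; [reflexivity | exact H]. }
    assert (xf : forall m n, m < n -> In (x m) (f n)).
    { intros m n Hmn. induction Hmn as [| n Hmn IH].
      - destruct (fS m) as [-> _]. left; reflexivity.
      - destruct (fS n) as [-> _]. right; exact IH. }
    destruct (@accumulation_in_range
      (fun n w => range w /\ D (mul (h (ginv G (x n))) w)) Z' HZ' Z'z) as [q Hq].
    { intros n. split; [| split].
      - apply open_inter; [exact range_open | apply (open_mul_l Hmul), HD].
      - exists (h (x n)). split; [exists (x n); reflexivity |]. rewrite hM. gsimp. exact D1.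
      - intros w [[g ->] Dg]. split; [exists g; reflexivity |].
        rewrite hM in Dg. intros Zg. destruct (fS n) as [_ [Cx _]].
        apply (Cx _ Dg). gsimp. exact Zg. }
    assert (HDq : open T (fun w => D (mul (h (ginv G q)) w))) by apply (open_mul_l Hmul), HD.
    assert (Dq : D (mul (h (ginv G q)) (h q))) by (rewrite hM; gsimp; exact D1).
    destruct (Hq _ HDq Dq 0) as [m [_ [g [[_ Dg] Dqg]]]].
    destruct (Hq _ HDq Dq (S m)) as [n [Hmn [g' [[_ Dg'] Dqg']]]].
    rewrite hM in *.
    (* Both [x m D] and [x n D] meet [q D], at [g] and [g']. Passing from [x m] through [g], [q] and
       [g'] to [x n] exhibits [x n] as [near] the earlier [x m]. *)
    destruct (fS n) as [_ [_ Hnear]]. apply (Hnear (x m)); [apply xf; exact Hmn |].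
    exists (gmul G (ginv G (x m)) g), (gmul G (ginv G q) g), (gmul G (ginv G q) g'),
      (gmul G (ginv G (x n)) g').
    repeat (split; [assumption |]). gsimp. reflexivity. }
  destruct Hcover as [l Hl].
  exists (fun v => Z' v /\ forall y, In y l -> Z (mul v (h y))).
  split; [| split].
  - apply open_inter; [exact HZ' |]. apply (open_forall_in _ l (fun y v => Z (mul v (h y)))).
    intros y _. apply (open_mul_r Hmul), HZ.
  - split; [exact Z'z |]. intros y _. rewrite zh. exact Zz.
  - intros g [Zg Hg]. destruct (Hl (ginv G g)) as [y [Hy [d1 [d2 [d3 [d4 [H1 [H2 [H3 [H4 E']]]]]]]]]].
    (* [ginv G g] is in [C]: if [g^-1 d] were in [Z'], then [d = g (g^-1 d)] would lie in [Z],
       although [D] lies in [O]. *)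
    { intros d [_ Dd] Zd. apply (HOZ (h d)); [apply E1O, EE1, Dd |].
      replace (h d) with (mul (h g) (h (gmul G (ginv G g) d))) by (rewrite hM; gsimp; reflexivity).
      apply HZZ; assumption. }
    apply (@closure_disjoint_open _ T O Z (h (gmul G g y)) HZ HOZ).
    (* Inverting the expression for [g^-1] gives [g y = d4 d3^-1 d2 d1^-1]. *)
    + rewrite <- (ginvK g), E'. gsimp.
      replace (gmul G d4 _) with
        (gmul G (gmul G d4 (ginv G d3)) (gmul G d2 (ginv G d1))) by (gsimp; reflexivity).
      rewrite <- hM. apply (closure_mul Hmul (A := E1) (B := E1)); auto.
    + rewrite <- hM. apply Hg, Hy.
Qed.
End ZeroIsolated.

(** * Inheritance of pseudocompactness *)

Lemma pseudocompact_surjection {X Y} (T : topology X) (TY : topology Y) (f : X -> Y) :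
  pseudocompact T ->
  (forall U, open TY U -> open T (fun x => U (f x))) -> (forall y, exists x, f x = y) ->
  pseudocompact TY.
Proof.
  intros Hpc Hf Hsurj F HF Hloc.
  destruct (pseudocompact_index_finite F (fun U x => U (f x)) Hpc) as [l Hl].
  - intros U FU. destruct (HF U FU) as [HU [y Uy]]. split; [apply Hf, HU |].
    destruct (Hsurj y) as [x <-]. exists x; exact Uy.
  - intros x. destruct (Hloc (f x)) as [W [HW [Wx [l Hl]]]].
    exists (fun x => W (f x)). split; [apply Hf, HW | split; [exact Wx |]].
    exists l. intros U FU [x' [Ux' Wx']].
    destruct (Hl U) as [V [HV HUV]]; [split; [exact FU | exists (f x'); auto] |].
    replace U with V; [exact HV |].
    extensionality y. symmetry. apply propositional_extensionality, HUV.
  - exists l. intros U FU. exists U. split; [apply Hl, FU | tauto].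
Qed.

(** [A] is a continuous image of the whole space: the identity on [C], the constant [d] off [C]. The
    point [d] may lie in [C], as for maximal subgroups, or outside it, as for the zero of a Brandt
    subsemigroup. *)
Lemma pseudocompact_clopen_point {X} (T : topology X) (A C : X -> Prop) (d : X) :
  pseudocompact T -> clopen T C -> (forall x, A x <-> C x \/ x = d) ->
  pseudocompact (subspace T A).
Proof.
  intros Hpc [HC HnC] HA.
  assert (CA : forall x, C x -> A x) by (intros x Cx; apply HA; auto).
  assert (Ad : A d) by (apply HA; auto).
  apply (@pseudocompact_surjection _ _ T _
    (fun x => match excluded_middle_informative (C x) with
              | left c => exist _ x (CA x c) | right _ => exist _ d Ad end) Hpc).
  - intros U [U' [HU' HUU]].
    (* Off [C] the map is constant, so the preimage there is everything or nothing according to the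
       proposition [U' d]. *)
    apply (@open_iff _ T (fun x => (C x /\ U' x) \/ (~ C x /\ U' d))).
    + intros x. destruct (excluded_middle_informative (C x)) as [c | c]; rewrite HUU; simpl; tauto.
    + apply open_or; apply open_inter; try assumption. apply open_const.
  - intros [y Ay]. exists y.
    destruct (excluded_middle_informative (C y)) as [c | c].
    + f_equal. apply proof_irrelevance.
    + destruct (proj1 (HA y) Ay) as [Cy | ->]; [contradiction |].
      f_equal. apply proof_irrelevance.
Qed.

(** * Algebra of the blocks of a primitive inverse semigroup *)

Section PrimitiveInverseSemigroup.
Context {I : Type} {L : I -> Type} {G : I -> Grp}.
Implicit Types z w : PIS L G.

Lemma pelt_inj i (a b c d : L i) (g h : G i) :
  pelt G i a g b = pelt G i c h d -> a = c /\ g = h /\ b = d.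
Proof.
  unfold pelt. intros H. injection H as Ha Hg Hb.
  apply inj_pair2 in Ha, Hg, Hb. auto.
Qed.

Lemma pmul_pelt i (a b d : L i) (g h : G i) :
  pmul (pelt G i a g b) (pelt G i b h d) = pelt G i a (gmul (G i) g h) d.
Proof.
  unfold pelt; simpl. destruct (excluded_middle_informative (i = i)) as [p |]; [| tauto].
  (* This turns the transport along [p : i = i] into the identity. *)
  rewrite (proof_irrelevance _ p eq_refl).
  destruct (excluded_middle_informative (b = b)); tauto.
Qed.

Lemma pmul_pelt_l_neq_None i (a b : L i) (g : G i) z :
  pmul (pelt G i a g b) z <> None -> exists h d, z = pelt G i b h d.
Proof.
  destruct z as [[j [[c h] d]] |]; [| simpl; tauto].
  simpl. destruct (excluded_middle_informative (i = j)) as [p |]; [| tauto].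
  destruct p. destruct (excluded_middle_informative (b = c)) as [<- |]; [| tauto].
  intros _. exists h, d. reflexivity.
Qed.

Lemma pmul_pelt_r_neq_None i (a b : L i) (g : G i) z :
  pmul z (pelt G i a g b) <> None -> exists c h, z = pelt G i c h a.
Proof.
  destruct z as [[j [[c h] d]] |]; [| simpl; tauto].
  simpl. destruct (excluded_middle_informative (j = i)) as [p |]; [| tauto].
  destruct p. destruct (excluded_middle_informative (d = a)) as [-> |]; [| tauto].
  intros _. exists c, h. reflexivity.
Qed.

Lemma pelt_neq_None i (a b : L i) (g : G i) : pelt G i a g b <> None.
Proof. discriminate. Qed.

(** The label of an H-class, with [i] packed in so that blocks over different groups can be
    compared. *)
Definition hindex i (a b : L i) : {i : I & (L i * L i)%type} := existT _ i (a, b).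

Lemma hindex_inj i (a b c d : L i) : hindex a b = hindex c d -> a = c /\ b = d.
Proof. intros H. apply inj_pair2 in H. injection H as -> ->. auto. Qed.

Lemma Gab_hindex i j (a b : L i) (c d : L j) z :
  Gab G i a b z -> Gab G j c d z -> hindex a b = hindex c d.
Proof.
  intros [g ->] [h H]. assert (E : i = j) by (injection H; auto).
  subst j. apply pelt_inj in H. destruct H as [-> [_ ->]]. reflexivity.
Qed.

Lemma nonzero_Gab z : z <> None -> exists i a b, Gab G i a b z.
Proof.
  destruct z as [[i [[a g] b]] |]; [| tauto]. intros _. exists i, a, b, g. reflexivity.
Qed.

(** Presents a block as a preimage of the non-zero elements under two translations by idempotents,
    which makes it open. *)
Lemma Gab_iff_corner i (a b : L i) z :
  Gab G i a b z <->
  pmul (pmul (pelt G i a (gone (G i)) a) z) (pelt G i b (gone (G i)) b) <> None.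
Proof.
  split.
  - intros [g ->]. rewrite !pmul_pelt. apply pelt_neq_None.
  - intros H.
    destruct (@pmul_pelt_l_neq_None i a a (gone (G i)) z) as [g [d ->]].
    { intros E. rewrite E in H. apply H. reflexivity. }
    rewrite pmul_pelt in H. apply pmul_pelt_r_neq_None in H. destruct H as [c [h H]].
    apply pelt_inj in H. destruct H as [_ [_ ->]]. exists g. reflexivity.
Qed.

(** Presents any block as a preimage of a maximal subgroup under a right translation, so that
    closedness need be proved on the diagonal only. *)
Lemma Gab_iff_diagonal i (a b : L i) z :
  Gab G i a b z <-> Gab G i a a (pmul z (pelt G i b (gone (G i)) a)).
Proof.
  split.
  - intros [g ->]. rewrite pmul_pelt. eexists; reflexivity.
  - intros H. destruct (@pmul_pelt_r_neq_None i b a (gone (G i)) z) as [c [g ->]].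
    { destruct H as [h ->]. apply pelt_neq_None. }
    rewrite pmul_pelt in H. destruct H as [h H]. apply pelt_inj in H.
    destruct H as [-> _]. exists g. reflexivity.
Qed.

(** * Topology of the blocks and of the zero *)

Section Topological.
Context {T : topology (PIS L G)}.
Hypothesis HT : hausdorff T.
Hypothesis Hmul : jointly_continuous T pmul.

Lemma open_Gab i (a b : L i) : open T (Gab G i a b).
Proof.
  assert (Hn : open T (fun z => z <> None)).
  { apply open_nbhd. intros z Hz. destruct (HT Hz) as [U [V [HU [_ [Uz [V0 HUV]]]]]].
    exists U; split; [exact HU | split; [exact Uz |]].
    intros w Uw ->. exact (HUV _ Uw V0). }
  eapply open_iff; [intros z; symmetry; apply Gab_iff_corner |].
  apply (open_mul_l Hmul _ (fun z => pmul z _ <> None)).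
  apply (open_mul_r Hmul _ (fun z => z <> None)), Hn.
Qed.

(** Local finiteness is automatic: a non-zero point has its own block as a neighbourhood, meeting at
    most one [R k], and at zero [V] meets none. *)
Lemma finitely_many_blocks_off_zero (D : {i : I & (L i * L i)%type} -> Prop)
  (R : {i : I & (L i * L i)%type} -> PIS L G -> Prop) (V : PIS L G -> Prop) :
  pseudocompact T ->
  open T V -> V None ->
  (forall k, D k -> open T (R k) /\ exists z, R k z) ->
  (forall k z, R k z -> Gab G (projT1 k) (fst (projT2 k)) (snd (projT2 k)) z /\ ~ V z) ->
  exists l, forall k, D k -> In k l.
Proof.
  intros Hpc HV V0 HR HRV.
  apply (pseudocompact_index_finite D R Hpc HR). intros z.
  destruct (classic (z = None)) as [-> | Hz].
  - exists V; split; [exact HV | split; [exact V0 |]].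
    exists nil. intros k _ [y [Ry Vy]]. exact (proj2 (HRV k y Ry) Vy).
  - destruct (nonzero_Gab Hz) as [i [a [b Hab]]].
    exists (Gab G i a b); split; [apply open_Gab | split; [exact Hab |]].
    exists (hindex a b :: nil). intros [j [c d]] _ [y [Ry Hy]]. left.
    apply HRV in Ry. destruct Ry as [Ry _]. exact (Gab_hindex Hy Ry).
Qed.

(** With [a] fixed, the blocks [(a,b)] and [(b,a)] cannot both lie in the closure of a small [V]
    around zero, since [(a,e,b)(b,e,a) = (a,e,a)] stays away from zero. So every [b] contributes a
    non-empty [R b]. *)
Lemma finite_index_sets i : pseudocompact T -> exists l : list (L i), forall a, In a l.
Proof.
  intros Hpc. destruct (classic (inhabited (L i))) as [[a] | HL].
  2:{ exists nil. intros a. apply HL, (inhabits a). }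
  destruct (HT (@pelt_neq_None i a a (gone (G i)))) as [O [W [HO [HW [Oe [W0 HOW]]]]]].
  destruct (square_nbhd Hmul _ (eq_refl : pmul (None : PIS L G) None = None) HW W0)
    as [V [HV [V0 [_ HVV]]]].
  set (R (b : L i) z := (Gab G i a b z \/ Gab G i b a z) /\ ~ closure T V z).
  destruct (@pseudocompact_index_finite _ (L i) T (fun _ => True) R Hpc) as [l Hl].
  - intros b _. split.
    + apply open_inter; [apply open_or; apply open_Gab | apply open_not_closure].
    + apply NNPP. intros Hno.
      assert (H : forall z, Gab G i a b z \/ Gab G i b a z -> closure T V z).
      { intros z Hz. apply NNPP. intros Hc. apply Hno. exists z. split; assumption. }
      refine (@closure_disjoint_open _ T W O _ HO (fun z Wz Oz => HOW z Oz Wz) _ Oe).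
      replace (pelt G i a (gone (G i)) a)
        with (pmul (pelt G i a (gone (G i)) b) (pelt G i b (gone (G i)) a))
        by (rewrite pmul_pelt, gmul1; reflexivity).
      apply (closure_mul Hmul W HVV); apply H; [left | right]; eexists; reflexivity.
  - intros z. destruct (classic (z = None)) as [-> | Hz].
    + exists V; split; [exact HV | split; [exact V0 |]].
      exists nil. intros b _ [y [[_ Hy] Vy]]. apply Hy, subset_closure, Vy.
    + destruct (nonzero_Gab Hz) as [j [c [d Hcd]]].
      exists (Gab G j c d); split; [apply open_Gab | split; [exact Hcd |]].
      destruct (classic (i = j)) as [<- | Hij].
      (* The block [(c,d)] can meet [R b] only if [b] is [d] or [c]. *)
      * exists (c :: d :: nil). intros b _ [y [[[Hy | Hy] _] Hcdy]];
          destruct (hindex_inj (Gab_hindex Hcdy Hy)) as [-> ->]; simpl; auto.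
      * exists nil. intros b _ [y [[[Hy | Hy] _] Hcdy]]; apply Hij;
          exact (f_equal (@projT1 _ _) (Gab_hindex Hy Hcdy)).
  - exists l. intros b. apply Hl, Logic.I.
Qed.

Lemma clopen_Gab i (a b : L i) : pseudocompact T -> clopen T (Gab G i a b).
Proof.
  intros Hpc. split; [apply open_Gab |].
  assert (Hdiag : closed T (Gab G i a a)).
  { assert (Hcl : forall z, z <> None -> ~ Gab G i a a z ->
      exists W, open T W /\ W z /\ forall w, W w -> ~ Gab G i a a w).
    { intros z Hz Hn. destruct (nonzero_Gab Hz) as [j [c [d Hcd]]].
      exists (Gab G j c d). split; [apply open_Gab | split; [exact Hcd |]].
      intros w Hw Haa. apply Hn. pose proof (Gab_hindex Haa Hw) as E.
      (* The goal is written as a function of the packed label, so that the equality of dependent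
         pairs [E] can rewrite [i] and both indices at once. *)
      change (Gab G (projT1 (hindex a a)) (fst (projT2 (hindex a a)))
                (snd (projT2 (hindex a a))) z).
      rewrite E. exact Hcd. }
    destruct (@zero_not_in_closure _ T pmul (G i) (fun g => pelt G i a g a) None)
      as [V [HV [V0 HVn]]]; auto.
    - intros g h. apply pmul_pelt.
    - intros g. apply pelt_neq_None.
    - apply open_Gab.
    (* Blocks are open and disjoint, so only zero can be added by the closure. *)
    - intros z Hz. destruct (classic (z = None)) as [Hz0 | Hz0]; [right; exact Hz0 | left].
      apply NNPP. intros Hn. destruct (Hcl z Hz0 Hn) as [W [HW [Wz HWn]]].
      destruct (Hz W HW Wz) as [w [Ww Hw]]. exact (HWn w Ww Hw).
    - apply open_nbhd. intros z Hz. destruct (classic (z = None)) as [-> | Hz0].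
      + exists V. split; [exact HV | split; [exact V0 |]].
        intros w Vw [g ->]. exact (HVn g Vw).
      + destruct (Hcl z Hz0 Hz) as [W [HW [Wz HWn]]]. exists W; auto. }
  apply (@open_iff _ T (fun z => ~ Gab G i a a (pmul z (pelt G i b (gone (G i)) a)))).
  - intros z. rewrite <- Gab_iff_diagonal. tauto.
  - apply (open_mul_r Hmul _ (fun z => ~ Gab G i a a z)), Hdiag.
Qed.

Lemma pseudocompact_Gab i (a : L i) :
  pseudocompact T -> pseudocompact (subspace T (Gab G i a a)).
Proof.
  intros Hpc.
  apply (@pseudocompact_clopen_point _ T _ (Gab G i a a) (pelt G i a (gone (G i)) a) Hpc).
  - apply clopen_Gab, Hpc.
  - intros z; split; [auto | intros [H | ->]; [exact H | eexists; reflexivity]].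
Qed.

Lemma pseudocompact_Bsub i : pseudocompact T -> pseudocompact (subspace T (Bsub G i)).
Proof.
  intros Hpc. destruct (finite_index_sets i Hpc) as [l Hl].
  (* The non-zero part is a union of finitely many clopen blocks, by finiteness of [L i]; zero is
     the extra point. *)
  apply (@pseudocompact_clopen_point _ T _ (fun z => exists a b, Gab G i a b z) None Hpc).
  - split.
    + apply open_nbhd. intros z [a [b H]].
      exists (Gab G i a b). split; [apply open_Gab | split; [exact H |]].
      intros w Hw. exists a, b; exact Hw.
    + apply (@open_iff _ T (fun z => forall k, In k (list_prod l l) ->
        ~ Gab G i (fst k) (snd k) z)).
      * intros z; split.
        -- intros H [a [b Hab]]. apply (H (a, b)); [apply in_prod; apply Hl | exact Hab].
        -- intros H [a b] _ Hab. apply H. exists a, b; exact Hab.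
      * apply (open_forall_in _ _ (fun k z => ~ Gab G i (fst k) (snd k) z)).
        intros k _. apply clopen_Gab, Hpc.
  - intros z; split.
    + intros [-> | [a [g [b ->]]]]; [right; reflexivity | left]. exists a, b, g; reflexivity.
    + intros [[a [b [g ->]]] | ->]; [right; exists a, g, b; reflexivity | left; reflexivity].
Qed.

Lemma paratopological_Gab i (a : L i) : paratopological_subgroup T pmul (Gab G i a a).
Proof.
  split; [| split].
  - exists (pelt G i a (gone (G i)) a). split; [eexists; reflexivity |].
    split; [| split].
    + intros x y [g ->] [h ->]. rewrite pmul_pelt. eexists; reflexivity.
    + intros x [g ->]. rewrite !pmul_pelt, gmul1, gmul1r. auto.
    + intros x [g ->]. exists (pelt G i a (ginv (G i) g) a).
      rewrite !pmul_pelt, gmulV, gmulVr. split; [eexists; reflexivity | auto].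
  - intros [x Hx] [y Hy] Hxy.
    assert (H : x <> y).
    { intros ->. apply Hxy. f_equal. apply proof_irrelevance. }
    destruct (HT H) as [U [V [HU [HV [Ux [Vy HUV]]]]]].
    exists (fun s => U (proj1_sig s)), (fun s => V (proj1_sig s)).
    split; [exists U; split; [exact HU | tauto] |].
    split; [exists V; split; [exact HV | tauto] |].
    split; [exact Ux | split; [exact Vy |]]. intros z Uz Vz. exact (HUV _ Uz Vz).
  - intros x y W _ _ HW Wxy. destruct (Hmul x y W HW Wxy) as [U [V [HU [HV [Ux [Vy H]]]]]].
    exists U, V. auto 10.
Qed.

(** The map from [u] to [(b,x,a) u (a,e,c)] is a homeomorphism from block [(a,a)] onto block
    [(b,c)], with inverse taking [z] to [(a,x^-1,b) z (c,e,a)]. Openness of an image is read off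
    from this inverse. *)
Lemma base_at_translate i (a : L i) (B : (PIS L G -> Prop) -> Prop) :
  base_at T (pelt G i a (gone (G i)) a) B ->
  (forall U, B U -> subset U (Gab G i a a)) ->
  forall (b c : L i) (x : G i),
  base_at T (pelt G i b x c)
    (fun V => exists U, B U /\ forall z, V z <->
       exists u, U u /\ z = pmul (pmul (pelt G i b x a) u) (pelt G i a (gone (G i)) c)).
Proof.
  intros [HB1 HB2] HBG b c x. split.
  - intros V [U [BU HVU]]. destruct (HB1 U BU) as [HU U1]. split.
    + apply (@open_iff _ T (fun z => Gab G i b c z /\
        U (pmul (pmul (pelt G i a (ginv (G i) x) b) z) (pelt G i c (gone (G i)) a)))).
      * intros z. rewrite HVU. split.
        -- intros [[g ->] Ug]. eexists; split; [exact Ug |].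
           rewrite !pmul_pelt. gsimp. reflexivity.
        -- intros [u [Uu ->]]. destruct (HBG U BU u Uu) as [g ->].
           rewrite !pmul_pelt. split; [eexists; reflexivity |].
           gsimp. exact Uu.
      * apply open_inter; [apply open_Gab |].
        apply (open_mul_l Hmul _ (fun z => U (pmul z _))).
        apply (open_mul_r Hmul _ U), HU.
    + apply HVU. eexists; split; [exact U1 |]. rewrite !pmul_pelt. gsimp. reflexivity.
  - intros W HW Wx.
    destruct (HB2 (fun u => W (pmul (pmul (pelt G i b x a) u) (pelt G i a (gone (G i)) c))))
      as [U [BU HUW]].
    + apply (open_mul_l Hmul _ (fun z => W (pmul z _))).
      apply (open_mul_r Hmul _ W), HW.
    + rewrite !pmul_pelt. gsimp. exact Wx.
    + exists (fun z => exists u, U u /\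
        z = pmul (pmul (pelt G i b x a) u) (pelt G i a (gone (G i)) c)).
      split; [exists U; split; [exact BU | reflexivity] |].
      intros z [u [Uu ->]]. apply HUW, Uu.
Qed.

(** For a regular open [U] around zero, only finitely many blocks leave the closure of [U]. Any
    other block, being open, lies in the interior of that closure, which is [U]. *)
Lemma base_at_zero :
  pseudocompact T -> semiregular T ->
  base_at T None
    (fun V => exists ks : list {i : I & (L i * L i)%type},
       forall z, V z <->
         ~ exists k, In k ks /\ Gab G (projT1 k) (fst (projT2 k)) (snd (projT2 k)) z).
Proof.
  intros Hpc Hsr. split.
  - intros V [ks HV]. split.
    + apply (@open_iff _ T (fun z => forall k, In k ks ->
        ~ Gab G (projT1 k) (fst (projT2 k)) (snd (projT2 k)) z)).
      * intros z. rewrite HV. split.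
        -- intros H [k [Hk Hz]]. exact (H k Hk Hz).
        -- intros H k Hk Hz. apply H. exists k; auto.
      * apply (open_forall_in _ ks (fun k z =>
          ~ Gab G (projT1 k) (fst (projT2 k)) (snd (projT2 k)) z)).
        intros k _. apply clopen_Gab, Hpc.
    + apply HV. intros [k [_ [g H]]]. discriminate H.
  - intros W HW W0. destruct (Hsr None W HW W0) as [U [HU [HrU [U0 HUW]]]].
    set (R (k : {i : I & (L i * L i)%type}) z :=
      Gab G (projT1 k) (fst (projT2 k)) (snd (projT2 k)) z /\ ~ closure T U z).
    destruct (@finitely_many_blocks_off_zero (fun k => exists z, R k z) R U Hpc HU U0) as [ks Hks].
    + intros k Hk. split; [| exact Hk].
      apply open_inter; [apply open_Gab | apply open_not_closure].
    + intros k z [H1 H2]. split; [exact H1 |]. intros Uz. apply H2, subset_closure, Uz.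
    + exists (fun z =>
        ~ exists k, In k ks /\ Gab G (projT1 k) (fst (projT2 k)) (snd (projT2 k)) z).
      split; [exists ks; reflexivity |].
      intros z Hz. apply HUW. apply NNPP. intros HnU.
      destruct (classic (z = None)) as [-> | Hz0]; [exact (HnU U0) |].
      destruct (nonzero_Gab Hz0) as [i [a [b Hab]]].
      apply Hz. exists (hindex a b). split; [| exact Hab].
      apply Hks. apply NNPP. intros Hno. apply HnU, HrU.
      exists (Gab G i a b). split; [apply open_Gab | split; [exact Hab |]].
      intros w Hw. apply NNPP. intros Hc. apply Hno. exists w. split; assumption.
Qed.
End Topological.
End PrimitiveInverseSemigroup.

Unset Implicit Arguments.

Theorem theorem3p5 (I : Type) (L : I -> Type) (G : I -> Grp)
  (T : topology (PIS L G))
  (Lne : forall i, inhabited (L i))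
  (HT : hausdorff T)
  (Hmul : jointly_continuous T (@pmul I L G))
  (Hpc : pseudocompact T) :
  (* (i) *)
  (forall i, exists l : list (L i), forall a, In a l) /\
  (* (ii) *)
  (forall i (a : L i), clopen T (Gab G i a a) /\ pseudocompact (subspace T (Gab G i a a))) /\
  (* (iii) *)
  (forall i, pseudocompact (subspace T (Bsub G i)) /\
     forall a : L i, pseudocompact (subspace T (Gab G i a a)) /\
       paratopological_subgroup T (@pmul I L G) (Gab G i a a)) /\
  (* (iv) *)
  (forall i (a : L i) (B : (PIS L G -> Prop) -> Prop),
     base_at T (pelt G i a (gone (G i)) a) B ->
     (forall U, B U -> subset U (Gab G i a a)) ->
     forall (b c : L i) (x : G i),
       base_at T (pelt G i b x c)
         (fun V => exists U, B U /\ forall z, V z <->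
            exists u, U u /\
              z = pmul (pmul (pelt G i b x a) u) (pelt G i a (gone (G i)) c))) /\
  (* (v) *)
  (semiregular T ->
     base_at T None
       (fun V => exists ks : list {i : I & (L i * L i)%type},
          forall z, V z <->
            ~ exists k, In k ks /\ Gab G (projT1 k) (fst (projT2 k)) (snd (projT2 k)) z)).
Proof.
  split; [| split; [| split; [| split]]].
  - intros i. exact (finite_index_sets HT Hmul i Hpc).
  - intros i a. split; [apply clopen_Gab | apply pseudocompact_Gab]; assumption.
  - intros i. split; [apply pseudocompact_Bsub; assumption |].
    intros a. split; [apply pseudocompact_Gab | apply paratopological_Gab]; assumption.
  - intros i a B. exact (base_at_translate HT Hmul (B := B)).
  - exact (base_at_zero HT Hmul Hpc).
Qed.
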